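(* Let $B=(V,E,\le)$ be an ordered simple Bratteli diagram of exact finite rank. Let $T:X_B\to X_B$ be the Vershik map defined by the order $\le$ on $B$ ($T$ is not necessarily continuous everywhere). Then the dynamical system $(X_B,\mu,T)$ is not strongly mixing with respect to the unique invariant measure $\mu$.
   Context: A Bratteli diagram $B=(V,E)$ is an infinite graph with vertex set $V=\bigsqcup_{i\ge 0}V_i$ and edge set $E=\bigsqcup_{i\ge 1}E_i$, all $V_i,E_i$ finite, $V_0=\{v_0\}$, with range and source maps $r(E_i)=V_i$, $s(E_i)=V_{i-1}$, $s^{-1}(v)\ne\emptyset$ for all $v$ and $r^{-1}(v)\ne\emptyset$ for $v\ne v_0$. $X_B$ is the space of infinite paths $x=(x_i)_{i\ge1}$ from $v_0$, topologized by cylinder sets. $B$ is simple if for every $n$ there is $m>n$ such that every vertex of $V_n$ is connected to every vertex of $V_m$ by a path. Standing assumptions on finite rank diagrams: the same number $d$ of vertices at each level $n\ge1$; a single edge from $v_0$ to each vertex of $V_1$; $X_B$ has no isolated points; the tail equivalence relation (paths agreeing from some level on) has no finite classes. An invariant measure is a non-atomic Borel measure on $X_B$ giving equal mass to the cylinder sets of any two finite paths from $v_0$ with the same range. A finite rank diagram (uniformly bounded $|V_n|$) is of exact finite rank if there are a finite invariant measure $\nu$ and a constant $\delta>0$ such that, after a telescoping (keeping a subsequence of levels and taking finite paths between consecutive kept levels as edges), $\nu(\{x: r(x_n)=v\})\ge\delta$ for all levels $n$ and all vertices $v\in V_n$. The source asserts that diagrams of exact finite rank are uniquely ergodic, i.e.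 have a unique invariant probability measure; the measure $\mu$ in the claim is this measure. $B$ is ordered if each set $r^{-1}(v)$, $v\in V\setminus V_0$, is linearly ordered. A (finite or infinite) path is maximal (minimal) if each of its edges $e_i$ is maximal (minimal) in $r^{-1}(r(e_i))$. Let $X_B^*$ be the set of infinite paths cofinal neither to a maximal nor to a minimal infinite path; for finite rank diagrams $X_B\setminus X_B^*$ is at most countable. The Vershik map $T:X_B^*\to X_B^*$ is $T(x_1,x_2,\dots)=(x_1^0,\dots,x_{k-1}^0,\overline{x_k},x_{k+1},\dots)$, where $k=\min\{n: x_n \text{ is not maximal}\}$, $\overline{x_k}$ is the successor of $x_k$ in $r^{-1}(r(x_k))$ and $(x_1^0,\dots,x_{k-1}^0)$ is the minimal path from $v_0$ to $s(\overline{x_k})$. It is thus defined $\mu$-almost everywhere and preserves $\mu$. Strongly mixing: $\mu(A\cap T^{-n}C)\to\mu(A)\mu(C)$ as $n\to\infty$ for all measurable $A,C$. *)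

(* Defs.v *)
(* MathComp-Analysis *)
From HB Require Import structures.
From mathcomp Require Import all_boot all_order all_algebra.
From mathcomp Require Import all_classical all_reals all_analysis.
Set Implicit Arguments.
Unset Strict Implicit.
Unset Printing Implicit Defensive.
Import Order.TTheory GRing.Theory Num.Theory.
Local Open Scope classical_set_scope.
Local Open Scope ring_scope.

(* Edges are indexed from 0: [edge n] is the usual E_{n+1}, the set of edges
   from level n to level n+1.  Likewise the edge x_{n+1} of an infinite path x
   is written [x n] below. *)
Record bratteli := Bratteli {
  vertex : nat -> finType;
  edge : nat -> finType;
  src : forall n, edge n -> vertex n;
  rng : forall n, edge n -> vertex n.+1;
  root : vertex 0;
  vertex0_root : forall v : vertex 0, v = root;
  src_onto : forall n (v : vertex n), exists e : edge n, src e = v;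
  rng_onto : forall n (v : vertex n.+1), exists e : edge n, rng e = v }.

Arguments src {b n} _.
Arguments rng {b n} _.
Arguments root {b}.

Inductive fin_path (B : bratteli) (m : nat) (v : vertex B m) :
    forall n, vertex B n -> Type :=
| fp_nil : fin_path v v
| fp_rcons n (e : edge B n) : fin_path v (src e) -> fin_path v (rng e).

(* No condition on [src (x 0)] is needed: level 0 has a single vertex. *)
Record path_space (B : bratteli) := PathSpace {
  path_edge :> forall n, edge B n;
  path_adj : forall n, rng (path_edge n) = src (path_edge n.+1) }.

Fixpoint follows (B : bratteli) (x : path_space B) n (w : vertex B n)
    (p : fin_path root w) : Prop :=
  match p with
  | fp_nil => True
  | fp_rcons n e p' => follows x p' /\ x n = e
  end.

Definition cylinder (B : bratteli) n (w : vertex B n) (p : fin_path root w) :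
  set (path_space B) := [set x | follows x p].

Definition cylinders (B : bratteli) : set (set (path_space B)) :=
  [set C | exists n (w : vertex B n) (p : fin_path root w), C = cylinder p].

Section PathSpaceInstances.
Context (B : bratteli).

Fixpoint some_edge (n : nat) : edge B n :=
  match n with
  | 0%N => sval (cid (src_onto (@root B)))
  | n'.+1 => sval (cid (src_onto (rng (some_edge n'))))
  end.

Lemma some_edge_adj n : rng (some_edge n) = src (some_edge n.+1).
Proof. by rewrite /=; case: cid. Qed.

HB.instance Definition _ := gen_eqMixin (path_space B).
HB.instance Definition _ := gen_choiceMixin (path_space B).
HB.instance Definition _ :=
  isPointed.Build (path_space B) (PathSpace some_edge_adj).

Lemma followsE (x y : path_space B) n (w : vertex B n) (p : fin_path root w) :
  follows x p -> follows y p <-> (forall i, (i < n)%N -> y i = x i).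
Proof.
elim: p => [|k e p IH] /=; first by move=> _; split.
case=> /IH {}IH xk; split=> [[/IH yx yk] i|yx].
  by rewrite ltnS leq_eqVlt => /orP[/eqP->|/yx//]; rewrite yk xk.
split; first by apply/IH => i ik; apply: yx; exact: ltnW.
by rewrite -xk; exact: yx.
Qed.

Lemma cylinders_cover : \bigcup_(C in @cylinders B) C = setT.
Proof.
apply/seteqP; split=> // x _; exists (cylinder (fp_nil root)) => //.
by exists 0%N, root, (fp_nil root).
Qed.

Lemma cylinders_join (C D : set (path_space B)) x :
  cylinders C -> cylinders D -> C x -> D x ->
  exists F, [/\ cylinders F, F x & F `<=` C `&` D].
Proof.
move=> Ccyl Dcyl; have := Ccyl; have := Dcyl.
move=> [m [v [p ->]]] [n [w [q ->]]] qx px.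
have [mn|/ltnW nm] := leqP m n.
- exists (cylinder q); split=> //; first by exists n, w, q.
  move=> y qy; split=> //; apply/(followsE y px) => i im.
  by apply: (followsE y qx).1 => //; exact: leq_trans mn.
- exists (cylinder p); split=> //; first by exists m, v, p.
  move=> y py; split=> //; apply/(followsE y qx) => i im.
  by apply: (followsE y px).1 => //; exact: leq_trans nm.
Qed.

HB.instance Definition _ := @isBaseTopological.Build (path_space B)
  (set (path_space B)) (@cylinders B) id cylinders_cover cylinders_join.

End PathSpaceInstances.

Notation borel_path B := (g_sigma_algebraType (@open (path_space B))).

Definition simple_diagram (B : bratteli) : Prop :=
  forall n, exists2 m, (n < m)%N &
    forall (v : vertex B n) (w : vertex B m), inhabited (fin_path v w).

Definition cofinal (B : bratteli) (x y : path_space B) : Prop :=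
  exists N, forall n, (N <= n)%N -> x n = y n.

Definition standing_assumptions (B : bratteli) : Prop :=
  [/\ exists d, forall n, #|vertex B n.+1| = d,
      forall v : vertex B 1, exists! e : edge B 0, rng e = v,
      isolated [set: path_space B] = set0 &
      forall x : path_space B, infinite_set [set y | cofinal x y]].

Definition nonatomic d (T : measurableType d) (R : realType)
    (mu : set T -> \bar R) : Prop :=
  forall A, measurable A -> (0 < mu A)%E ->
    exists C, [/\ measurable C, C `<=` A, (0 < mu C)%E & (mu C < mu A)%E].

Definition invariant_measure (R : realType) (B : bratteli)
    (mu : {measure set (borel_path B) -> \bar R}) : Prop :=
  nonatomic mu /\
  forall n (w : vertex B n) (p q : fin_path root w),
    mu (cylinder p) = mu (cylinder q).

(* Measures are compared on Borel sets only: a library measure also carries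
   irrelevant values on non-measurable sets. *)
Definition unique_invariant_probability (R : realType) (B : bratteli)
    (mu : probability (borel_path B) R) : Prop :=
  invariant_measure mu /\
  forall mu' : probability (borel_path B) R, invariant_measure mu' ->
    forall A : set (borel_path B), measurable A -> mu' A = mu A.

Definition finite_rank (B : bratteli) : Prop :=
  exists d, forall n, (#|vertex B n| <= d)%N.

(* Paths whose vertex at level n+1 is v. *)
Definition tower (B : bratteli) n (v : vertex B n.+1) : set (path_space B) :=
  [set x | rng (x n) = v].

(* The telescoping keeps level 0 and the levels [(l k).+1].  Its path space is
   canonically X_B, and its towers are the towers of B at the kept levels. *)
Definition exact_finite_rank (R : realType) (B : bratteli) : Prop :=
  finite_rank B /\
  exists (nu : {finite_measure set (borel_path B) -> \bar R}) (delta : R)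
         (l : nat -> nat),
    [/\ invariant_measure nu, 0 < delta,
        forall k, (l k < l k.+1)%N &
        forall k (v : vertex B (l k).+1), (delta%:E <= nu (tower v))%E].

Record ordered_bratteli := OrderedBratteli {
  diagram :> bratteli;
  edge_le : forall n, rel (edge diagram n);
  edge_le_refl : forall n (e : edge diagram n), edge_le e e;
  edge_le_anti : forall n (e f : edge diagram n),
    rng e = rng f -> edge_le e f -> edge_le f e -> e = f;
  edge_le_trans : forall n (e f g : edge diagram n),
    rng e = rng f -> rng f = rng g ->
    edge_le e f -> edge_le f g -> edge_le e g;
  edge_le_total : forall n (e f : edge diagram n),
    rng e = rng f -> edge_le e f || edge_le f e }.

Section Vershik.
Context (B : ordered_bratteli).

Definition max_edge n (e : edge B n) : Prop :=
  forall f, rng f = rng e -> edge_le f e.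

Definition min_edge n (e : edge B n) : Prop :=
  forall f, rng f = rng e -> edge_le e f.

Definition succ_edge n (e f : edge B n) : Prop :=
  [/\ rng f = rng e, edge_le e f, f != e &
      forall g, rng g = rng e -> edge_le e g -> g != e -> edge_le f g].

Definition max_path (x : path_space B) : Prop := forall n, max_edge (x n).

Definition min_path (x : path_space B) : Prop := forall n, min_edge (x n).

(* The set X_B^*. *)
Definition vershik_domain : set (path_space B) :=
  [set x | forall y, max_path y \/ min_path y -> ~ cofinal x y].

Definition vershik_step (x y : path_space B) : Prop :=
  exists k, [/\ forall i, (i < k)%N -> max_edge (x i),
                ~ max_edge (x k),
                forall i, (i < k)%N -> min_edge (y i),
                succ_edge (x k) (y k) &
                forall i, (k < i)%N -> y i = x i].

(* [vershik_step x] determines [y]; outside of the co-countable set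
   [vershik_domain] the map is unconstrained. *)
Definition vershik_map (T : path_space B -> path_space B) : Prop :=
  forall x, vershik_domain x -> vershik_step x (T x).

End Vershik.

Definition strongly_mixing d (X : measurableType d) (R : realType)
    (mu : probability X R) (T : X -> X) : Prop :=
  forall A C : set X, measurable A -> measurable C ->
    (fun n => mu (A `&` (iter n T @^-1` C))) @ \oo --> (mu A * mu C)%E.

(* Main.v *)
Require Import Defs.
From mathcomp Require Import all_boot all_order all_algebra.
From mathcomp Require Import all_classical all_reals all_analysis.
Set Implicit Arguments.
Unset Strict Implicit.
Unset Printing Implicit Defensive.
Import Order.TTheory GRing.Theory Num.Theory.
Local Open Scope classical_set_scope.
Local Open Scope ring_scope.

(** The paths through a vertex w of level n form a Kakutani-Rokhlin tower whose
    floors, ordered by rank, are permuted upwards by T and have equal mass.  Let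
    t be smaller than the height of the lowest tower of level n.  If x lies on
    floor t of a tower of height h, then T^h x lies again on floor t of some
    tower.  Iterating this d+1 times, where d bounds the number of towers, the
    orbit visits some tower twice, so T^s x and T^(s+q) x have the same first n
    edges for some s, q read off the list of the d+1 visited towers.  The lowest
    tower has mass at least c by exact finite rank, and the number of such lists
    is bounded in terms of d alone, so for some q, at least the height of a
    tower, the points z for which z and T^q z have the same first m <= n edges
    have mass at least b, with b > 0 independent of m and n.  But this mass is
    the sum of mu(A & T^-q A) over the cylinders A of level m, and under strong
    mixing it tends to the sum of mu(A)^2 as q goes to infinity; this is at most
    the largest mu(A), hence smaller than b for large m. *)

(** * Paths and tower heights *)

Definition vtx (B : bratteli) (x : path_space B) n : vertex B n := src (x n).

Definition agree (B : bratteli) n (x y : path_space B) : Prop :=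
  forall i, (i < n)%N -> y i = x i.

Section Paths.
Context (B : bratteli).
Implicit Types x y z : path_space B.

Lemma path_space_ext x y : (forall n, x n = y n) -> x = y.
Proof.
case: x y => [f fA] [g gA] /= fg.
have fgE : f = g by exact: functional_extensionality_dep.
by rewrite fgE in fA *; rewrite (Prop_irrelevance fA gA).
Qed.

Lemma agree_sym n x y : agree n x y -> agree n y x.
Proof. by move=> xy i /xy. Qed.

Lemma agree_trans n x y z : agree n x y -> agree n y z -> agree n x z.
Proof. by move=> xy yz i i_n; rewrite yz ?xy. Qed.

Lemma agreeW m n x y : (m <= n)%N -> agree n x y -> agree m x y.
Proof. by move=> mn xy i im; apply: xy; exact: leq_trans mn. Qed.

Lemma vtxS x n : vtx x n.+1 = rng (x n).
Proof. by rewrite /vtx path_adj. Qed.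

Lemma agree_vtx n x y : agree n x y -> vtx y n = vtx x n.
Proof.
case: n => [|n] xy; last by rewrite !vtxS xy.
by rewrite (vertex0_root (vtx x 0)) (vertex0_root (vtx y 0)).
Qed.

Lemma follows_vtx n (w : vertex B n) (p : fin_path Defs.root w) x :
  follows x p -> vtx x n = w.
Proof.
case: p => [|k e p] /=; first by rewrite (vertex0_root (vtx x 0)).
by case=> _ <-; rewrite vtxS.
Qed.

Lemma agreeS n x y : agree n.+1 x y <-> agree n x y /\ y n = x n.
Proof.
split=> [xy|[xy yn] i]; first by split=> [i i_n|]; apply: xy => //; exact: ltnW.
by rewrite ltnS leq_eqVlt => /orP[/eqP->//|/xy].
Qed.

(** Reduces counting finitely many distinct paths to counting initial segments at a single level. *)
Lemma agree_separates (s : seq (path_space B)) : exists N,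
  {in s &, forall x y, agree N x y -> x = y}.
Proof.
elim: s => [|a s [N HN]]; first by exists 0%N.
have [M HM] : exists M, {in s, forall x, agree M a x -> a = x}.
  elim: {HN} s => [|b s [M HM]]; first by exists 0%N.
  have [ab|ab] := pselect (a = b).
    by rewrite -ab; exists M => x; rewrite inE => /orP[/eqP->//|/HM].
  have [k abk] : exists k, b k <> a k.
    by apply/existsNP => ba; apply: ab; apply: path_space_ext => k; rewrite ba.
  exists (maxn M k.+1) => x; rewrite inE => /orP[/eqP-> ax|xs ax].
    by case: abk; apply: ax; rewrite leq_max ltnSn orbT.
  by apply: HM => //; apply: agreeW ax; rewrite leq_maxl.
exists (maxn N M) => x y; rewrite !inE => /orP[/eqP->|xs] /orP[/eqP->|ys] xy //.
- by apply: HM => //; apply: agreeW xy; rewrite leq_maxr.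
- by apply/esym/HM => //; apply/agree_sym; apply: agreeW xy; rewrite leq_maxr.
- by apply: HN => //; apply: agreeW xy; rewrite leq_maxl.
Qed.

(** The number of finite paths from the root to the vertex, counted by last edge. *)
Fixpoint height n : vertex B n -> nat :=
  match n with
  | 0%N => fun=> 1%N
  | n'.+1 => fun w => (\sum_(e : edge B n' | rng e == w) height (src e))%N
  end.

Lemma heightS n (w : vertex B n.+1) :
  height w = (\sum_(e : edge B n | rng e == w) height (src e))%N.
Proof. by []. Qed.

Lemma height_gt0 n (w : vertex B n) : (0 < height w)%N.
Proof.
elim: n w => // n IH w; have [e ew] := rng_onto w.
by rewrite heightS (bigD1 e) ?ew //= addn_gt0 IH.
Qed.

Lemma height_src n (e : edge B n) : (height (src e) <= height (rng e))%N.
Proof. by rewrite heightS (bigD1 e) //= leq_addr. Qed.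

Lemma height_fin_path m n (v : vertex B m) (w : vertex B n) (p : fin_path v w) :
  (height v <= height w)%N.
Proof. by elim: p => // k e p /leq_trans; apply; exact: height_src. Qed.

End Paths.

(** * Ranks of paths in the towers *)

Section Rank.
Context {B : ordered_bratteli}.
Implicit Types x y z : path_space B.
Local Open Scope nat_scope.

(** [edge_le] is constrained only between edges of equal range, so equality of ranges is part of the
    strict order. *)
Definition ltE n (f e : edge B n) : bool :=
  [&& rng f == rng e, edge_le f e & f != e].

(** The number of finite paths from the root whose last edge strictly precedes [e]. *)
Definition below n (e : edge B n) : nat :=
  \sum_(f : edge B n | ltE f e) height (src f).

(* The number of paths to [vtx x n] that precede the first n edges of [x] in the
   order in which the Vershik map runs through them. *)
Definition rank x n : nat := \sum_(i < n) below (x i).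

Lemma rankS x n : rank x n.+1 = rank x n + below (x n).
Proof. by rewrite /rank big_ord_recr. Qed.

Lemma ltE_trans n : transitive (@ltE n).
Proof.
move=> e f g /and3P[/eqP fe fle fne] /and3P[/eqP eg ele ene].
rewrite /ltE fe eg eqxx /= (edge_le_trans _ _ fle ele)//=.
apply/eqP => fg; subst g; move: ene; rewrite (edge_le_anti _ ele fle) ?eqxx //.
Qed.

Lemma ltE_irr n (e : edge B n) : ltE e e = false.
Proof. by rewrite /ltE !eqxx !andbF. Qed.

Lemma ltE_total n (e f : edge B n) : rng e = rng f -> e != f ->
  ltE e f \/ ltE f e.
Proof.
move=> ef enf; rewrite /ltE ef eqxx /= enf eq_sym enf !andbT /=.
exact/orP/edge_le_total.
Qed.

(** The paths ending in [e] occupy an interval of ranks of length [height (src e)] starting at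
    [below e]. By transitivity [e] and all edges before it precede [f], so the intervals of edges
    with equal range are disjoint and ordered like the edges. *)
Lemma below_lt n (e f : edge B n) : ltE e f ->
  below e + height (src e) <= below f.
Proof.
move=> ef; rewrite /below [leqRHS](bigD1 e)//= addnC leq_add2l.
rewrite [leqRHS]big_mkcond /= [leqLHS]big_mkcond /=; apply: leq_sum => g _.
case: ifPn => // ge; rewrite (ltE_trans ge ef) /=.
by case: eqVneq => // gE; rewrite gE ltE_irr in ge.
Qed.

Lemma below_rng n (e : edge B n) :
  below e + height (src e) <= height (rng e).
Proof.
rewrite heightS [leqRHS](bigD1 e)//= addnC leq_add2l /below.
rewrite [leqRHS]big_mkcond /= [leqLHS]big_mkcond /=; apply: leq_sum => g _.
case: ifPn => // /[dup] ge /and3P[-> _ ->] //.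
Qed.

Lemma below_max n (e : edge B n) : max_edge e ->
  below e + height (src e) = height (rng e).
Proof.
move=> emax; rewrite heightS [RHS](bigD1 e)//= addnC; congr addn.
apply: eq_bigl => f; rewrite /ltE; case: eqP => //= fe.
by rewrite emax.
Qed.

Lemma below_min n (e : edge B n) : min_edge e -> below e = 0.
Proof.
move=> emin; rewrite /below big1 // => f /and3P[/eqP fe fle fne].
by move: fne; rewrite (edge_le_anti fe fle (emin _ fe)) eqxx.
Qed.

Lemma below_succ n (e f : edge B n) : succ_edge e f ->
  below f = below e + height (src e).
Proof.
case=> fe ef fne fmin; rewrite /below (bigD1 e) /=; last first.
  by rewrite /ltE fe eqxx ef eq_sym fne.
rewrite addnC; congr addn; apply: eq_bigl => g.
rewrite /ltE fe; case: (rng g =P rng e) => //= ge.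
apply/idP/idP => [/andP[/andP[gf gnf] gne]|/andP[gle gne]].
  apply/andP; split=> //; have /orP[//|eg] := edge_le_total ge.
  have fg := fmin _ ge eg gne.
  by move: gnf; rewrite (edge_le_anti _ gf fg) ?eqxx // ge fe.
rewrite gne andbT (edge_le_trans _ _ gle ef) //=.
by apply/eqP => gE; subst g; move: fne; rewrite (edge_le_anti fe gle ef) eqxx.
Qed.

Lemma below_inj n (e f : edge B n) a b : rng e = rng f ->
  a < height (src e) -> b < height (src f) ->
  a + below e = b + below f -> e = f /\ a = b.
Proof.
move=> ef ae bf ab; have [ee|ne] := eqVneq e f.
  by subst f; split=> //; apply: (@addIn (below e)).
have [/below_lt l|/below_lt l] := ltE_total ef ne; exfalso.
  have : a + below e < below f by rewrite addnC (leq_trans _ l) // ltn_add2l.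
  by rewrite ab ltnNge leq_addl.
have : b + below f < below e by rewrite addnC (leq_trans _ l) // ltn_add2l.
by rewrite -ab ltnNge leq_addl.
Qed.

(** The intervals leave no gap: among the edges whose interval ends after [t], take the one with
    least [below]. If it started after [t], its immediate predecessor, whose interval ends where its
    own starts, would contradict minimality. *)
Lemma below_cover n (w : vertex B n.+1) t : t < height w ->
  exists2 e : edge B n, rng e = w & below e <= t < below e + height (src e).
Proof.
move=> tw; have [e0 e0w] := rng_onto w.
case: (arg_maxnP (P := fun e : edge B n => rng e == w) (@below n)
  (introT eqP e0w)) => m /eqP mw mmax.
(* [m] maximizes [below], hence is the maximal edge, whose interval ends at [height w]. *)
have tm : t < below m + height (src m).
  rewrite below_max ?mw // => f; rewrite mw => fw.
  have [<-|fm] := eqVneq f m; first exact: edge_le_refl.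
  have [|/and3P[]//|/below_lt] := @ltE_total _ f m _ fm; first by rewrite fw.
  move=> H; have := mmax f (introT eqP fw) => /(leq_trans H).
  by rewrite -{2}[below m]addn0 leq_add2l leqNgt height_gt0.
pose Q := [pred e : edge B n | (rng e == w) && (t < below e + height (src e))].
have Qm : Q m by rewrite /= mw eqxx.
case: (arg_minnP (P := Q) (@below n) Qm) => e /andP[/eqP ew te] emin.
exists e => //; rewrite te andbT leqNgt; apply/negP => tle.
have [f0 f0e] : exists f, ltE f e.
  apply/existsP; rewrite -[[exists _, _]]negbK negb_exists; apply/negP => /forallP ne.
  by move: tle; rewrite /below big1 // => f; rewrite (negbTE (ne f)).
case: (arg_maxnP (P := fun f => ltE f e) (@below n) f0e) => f fe fmax.
have bE : below e = below f + height (src f).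
  rewrite {1}/below (bigD1 f)//= addnC; congr addn; apply: eq_bigl => g.
  apply/andP/idP => [[ge gf]|gf]; last first.
    by split; [exact: ltE_trans fe|apply/eqP => gE; rewrite gE ltE_irr in gf].
  have [|//|/below_lt H] := @ltE_total _ g f _ gf.
    by move: ge fe => /and3P[/eqP -> _ _] /and3P[/eqP].
  have := leq_trans H (fmax _ ge).
  by rewrite -{2}[below f]addn0 leq_add2l leqNgt height_gt0.
have fw : rng f = w by rewrite -ew; move: fe => /and3P[/eqP].
have /emin : Q f by rewrite /= fw eqxx -bE.
rewrite leqNgt => /negP; apply.
by rewrite bE -{1}[below f]addn0 ltn_add2l height_gt0.
Qed.

Lemma rank_height x n : rank x n < height (vtx x n).
Proof.
elim: n => [|n IH]; first by rewrite /rank big_ord0 height_gt0.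
rewrite rankS vtxS; apply: leq_trans (below_rng _); rewrite addnC ltn_add2l.
exact: IH.
Qed.

Lemma rank_max x n : (forall i, i < n -> max_edge (x i)) ->
  (rank x n).+1 = height (vtx x n).
Proof.
elim: n => [|n IH] xmax; first by rewrite /rank big_ord0.
rewrite rankS vtxS -(below_max (xmax n (ltnSn n))) addnC -addnS IH // => i i_n.
by apply: xmax; exact: ltnW.
Qed.

Lemma rank_min x n : (forall i, i < n -> min_edge (x i)) -> rank x n = 0.
Proof. by move=> xmin; rewrite /rank big1 // => i _; exact/below_min/xmin. Qed.

(** Vertex and rank are complete coordinates of the first n edges: [below_inj] recovers the last
    edge and the rank one level down. *)
Lemma rank_agree x y n : vtx x n = vtx y n -> rank x n = rank y n ->
  agree n x y.
Proof.
elim: n => // n IH; rewrite !vtxS !rankS => xy /esym.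
move=> /(below_inj (esym xy) (rank_height y n) (rank_height x n))[yx r].
by apply/agreeS; split=> //; apply: IH => //; rewrite /vtx yx.
Qed.

Lemma agree_rank x y n : agree n x y -> rank y n = rank x n.
Proof. by move=> xy; apply: eq_bigr => i _; rewrite xy. Qed.

Fixpoint path_rank n (w : vertex B n) (p : fin_path Defs.root w) : nat :=
  match p with
  | fp_nil => 0
  | fp_rcons n e p' => path_rank p' + below e
  end.

Lemma follows_rank n (w : vertex B n) (p : fin_path Defs.root w) x :
  follows x p -> rank x n = path_rank p.
Proof.
elim: p => [|k e p IH] /=; first by rewrite /rank big_ord0.
by case=> /IH <- <-; rewrite rankS.
Qed.

Lemma path_rank_onto n (w : vertex B n) t : t < height w ->
  exists p : fin_path Defs.root w, path_rank p = t.
Proof.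
elim: n w t => [|n IH] w t tw.
  by rewrite (vertex0_root w); exists (fp_nil Defs.root); case: t tw.
have [e ew /andP[et te]] := below_cover tw; subst w.
have [|p pt] := IH (src e) (t - below e); first by rewrite ltn_subLR.
by exists (fp_rcons p); rewrite /= pt subnK.
Qed.

Lemma followsP n (w : vertex B n) (p : fin_path Defs.root w) x :
  follows x p <-> vtx x n = w /\ rank x n = path_rank p.
Proof.
split=> [xp|]; first by rewrite (follows_vtx xp) (follows_rank xp).
elim: p => [|k e p IH] //=; rewrite vtxS rankS => -[xe].
have [q qE] : exists q : fin_path Defs.root (src e), path_rank q = path_rank p.
  by exists p.
have pe : path_rank p < height (src e).
  clear -p; move: (src e) p => w p; elim: p => //= n f p pf.
  by apply: leq_trans (below_rng _); rewrite addnC ltn_add2l.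
move=> /(below_inj xe (rank_height x k) pe)[xk r].
by split=> //; apply: IH; split=> //; rewrite /vtx xk.
Qed.

(** Let k be the index of the changed edge. For n <= k the first n edges pass from all maximal to
    all minimal, from a top floor to a bottom one. For n > k, the edges before k lower the rank from
    [height (src (x k))] minus one to 0, while [below] grows by [height (src (x k))]; the net gain
    of one persists at later levels. *)
Lemma vershik_step_rank x y n : vershik_step x y ->
  ((rank x n).+1 < height (vtx x n) ->
    vtx y n = vtx x n /\ rank y n = (rank x n).+1) /\
  ((rank x n).+1 = height (vtx x n) -> rank y n = 0).
Proof.
case=> k [xmax xk ymin ys yx].
have [nk|kn] := leqP n k.
  have -> : rank y n = 0 by rewrite rank_min // => i ik; apply/ymin/leq_trans/nk.
  by rewrite rank_max ?ltnn // => i ik; apply/xmax/leq_trans/nk.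
have rE : forall m, k < m -> vtx y m = vtx x m /\ rank y m = (rank x m).+1.
  elim=> // m IH; rewrite ltnS leq_eqVlt => /orP[/eqP <-|/[dup] km /IH[v r]].
    rewrite !vtxS !rankS (below_succ ys) (rank_min ymin) add0n.
    rewrite -[height (src (x k))]/(height (vtx x k)) -(rank_max xmax) addnS addnC.
    by case: ys.
  by rewrite !rankS r !vtxS yx.
split=> [_|xn]; first exact: rE.
have [v r] := rE _ kn.
by have := rank_height y n; rewrite v r xn ltnn.
Qed.

Lemma vershik_step_cofinal x y : vershik_step x y -> cofinal x y.
Proof. by case=> k [_ _ _ _ yx]; exists k.+1 => n /yx. Qed.

Lemma vershik_step_domain x y :
  vershik_step x y -> vershik_domain x -> vershik_domain y.
Proof.
move=> /vershik_step_cofinal[N xy] xD z zz [M yz]; apply: (xD z zz).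
exists (maxn N M) => n; rewrite geq_max => /andP[/xy -> /yz //].
Qed.

Lemma below_topS x n : (rank x n).+1 < height (vtx x n) ->
  (rank x n.+1).+1 < height (vtx x n.+1).
Proof.
move=> xn; rewrite vtxS rankS; apply: leq_trans (below_rng _).
by rewrite -!addSn addnC leq_add2l.
Qed.

(** Just after the changed edge [y] has positive rank, since that edge is a successor, whereas a top
    floor is sent to rank 0. *)
Lemma vershik_step_below_top x y : vershik_step x y ->
  exists k, forall n, k <= n -> (rank x n).+1 < height (vtx x n).
Proof.
move=> s; have [k [_ _ _ ys _]] := s; exists k.+1 => n kn.
rewrite -(subnK kn); elim: (n - k.+1) => [|m]; last exact: below_topS.
have [_ /(_ _)] := vershik_step_rank k.+1 s.
rewrite ltn_neqAle rank_height andbT => H; apply/eqP => /H.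
rewrite rankS (below_succ ys) => /eqP; rewrite !addn_eq0 => /andP[_ /andP[_]].
by rewrite gtn_eqF ?height_gt0.
Qed.

(** At a level where [x] is below the top of its tower, vertex and rank of [x] determine those of
    [y]. *)
Lemma vershik_step_continuous x y n : vershik_step x y -> exists m,
  forall x' y', vershik_step x' y' -> agree m x x' -> agree n y y'.
Proof.
move=> s; have [k xtop] := vershik_step_below_top s; exists (maxn n k) => x' y' s' xx'.
set m := maxn n k in xx'; have xm := xtop m (leq_maxr _ _).
have x'm : (rank x' m).+1 < height (vtx x' m).
  by rewrite (agree_vtx xx') (agree_rank xx').
have [vy ry] := (vershik_step_rank m s).1 xm.
have [vy' ry'] := (vershik_step_rank m s').1 x'm.
apply: (agreeW (leq_maxl n k)); apply: rank_agree.
  by rewrite vy vy' (agree_vtx xx').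
by rewrite ry ry' (agree_rank xx').
Qed.

End Rank.

(** * Orbits of the Vershik map *)

Lemma infinite_set_seq (T : choiceType) (A : set T) n : infinite_set A ->
  exists s : seq T, [/\ uniq s, (n <= size s)%N & forall x, x \in s -> A x].
Proof.
move=> /(infinite_set_fset n)[F FA nF]; exists (finmap.enum_fset F).
by split=> //; exact: finmap.fset_uniq.
Qed.

Section Dynamics.
Context {B : ordered_bratteli}.
Implicit Types x y z : path_space B.
Local Open Scope nat_scope.

(** [K] distinct paths cofinal with [x] share its vertex at some level and have distinct ranks
    there, so this vertex is high. Simplicity carries the bound to all vertices of a later level,
    and heights never decrease along edges. *)
Lemma height_unbounded x : simple_diagram B ->
  infinite_set [set y | cofinal x y] ->
  forall K, exists N, forall n (w : vertex B n), N <= n -> K <= height w.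
Proof.
move=> Bs xinf K; have [s [s_uniq Ks sx]] := infinite_set_seq K xinf.
have [N0 sep] := agree_separates s.
have [N1 xs] : exists N1, forall y n, y \in s -> N1 <= n -> x n = y n.
  elim: {Ks sep s_uniq} s sx => [|y s IH] sx; first by exists 0.
  have [|M HM] := IH; first by move=> z zs; apply: sx; rewrite inE zs orbT.
  have [M' HM'] := sx y (mem_head _ _).
  exists (maxn M M') => z n; rewrite inE geq_max => /orP[/eqP->|zs] /andP[? ?].
    exact: HM'.
  exact: HM.
pose N := maxn N0 N1.
have vE y : y \in s -> vtx y N = vtx x N.
  by move=> ys; rewrite /vtx (xs y) // leq_maxr.
have KN : K <= height (vtx x N).
  apply: (leq_trans Ks); rewrite -(size_map (rank^~ N) s) -[leqRHS](size_iota 0).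
  apply: uniq_leq_size.
    rewrite map_inj_in_uniq // => y z ys zs yz; apply: sep => //.
    apply: (@agreeW _ _ N); first exact: leq_maxl.
    by apply: rank_agree => //; rewrite !vE.
  by move=> _ /mapP[y ys ->]; rewrite mem_iota /= add0n -(vE _ ys) rank_height.
have [M NM conn] := Bs N; exists M.
have KM (w : vertex B M) : K <= height w.
  by have [p] := conn (vtx x N) w; exact/(leq_trans KN)/(height_fin_path p).
move=> n w Mn; rewrite -(subnK Mn) in w *; elim: (n - M) w => [|k IH] w.
  exact: KM.
have [e <-] := rng_onto w; exact: leq_trans (IH _) (height_src e).
Qed.

Lemma cofinal_countable x : countable [set y | cofinal x y].
Proof.
have -> : [set y | cofinal x y] =
    \bigcup_N [set y | forall n, N <= n -> x n = y n].
  by apply/seteqP; split=> y [N xy]; exists N.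
apply: bigcup_countable => // N _; apply/countable_injP; exists (rank^~ N).
move=> y z /set_mem xy /set_mem xz /= yz.
have yzN : agree N y z.
  by apply: rank_agree => //; rewrite /vtx -(xy N) // -(xz N).
apply: path_space_ext => n; have [/yzN//|Nn] := ltnP n N.
by rewrite -(xy n) // -(xz n).
Qed.

(** Meant for the maximal and the minimal paths, whose rank is a function of the vertex: each level
    has at most one initial segment per vertex. *)
Lemma rank_determined_finite (S : set (path_space B))
    (phi : forall n, vertex B n -> nat) :
  finite_rank B -> (forall x n, S x -> rank x n = phi n (vtx x n)) ->
  finite_set S.
Proof.
move=> [d Bd] Sphi; apply: contrapT => /(infinite_set_seq d.+1)[s [su ds sS]].
have [N sep] := agree_separates s.
suff sN : size s <= #|vertex B N|.
  by have := leq_trans ds (leq_trans sN (Bd N)); rewrite ltnn.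
rewrite -(size_map (fun x => vtx x N)) cardE; apply: uniq_leq_size; last first.
  by move=> w _; rewrite mem_enum.
rewrite map_inj_in_uniq // => x y xs ys xy; apply: sep => //.
by apply: rank_agree => //; rewrite !Sphi ?xy; [|exact: sS..].
Qed.

(** There are finitely many maximal and minimal paths, and each cofinality class is countable. *)
Lemma vershik_domainC_countable :
  finite_rank B -> countable (~` @vershik_domain B).
Proof.
move=> Bd.
have -> : ~` @vershik_domain B =
    \bigcup_(y in [set y | max_path y] `|` [set y | min_path y])
      [set x | cofinal y x].
  apply/seteqP; split=> [x /existsNP[y /not_implyP[yy /contrapT xy]]|x [y yy xy]].
    exists y; first by case: yy; [left|right].
    by case: xy => N xy; exists N => n /xy.
  move=> /(_ y yy); apply; case: xy => N xy; by exists N => n /xy.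
apply: bigcup_countable => [|y _]; last exact: cofinal_countable.
apply: finite_set_countable; rewrite finite_setU; split.
  apply: (@rank_determined_finite _ (fun n w => (height w).-1)) => // x n xmax.
  by rewrite -(rank_max (n := n)) // => i _; exact: xmax.
apply: (@rank_determined_finite _ (fun n w => 0)) => // x n xmin.
by rewrite rank_min // => i _; exact: xmin.
Qed.

Section Map.
Context (T : path_space B -> path_space B) (TV : vershik_map T).
Local Notation dom := (@vershik_domain B).

Lemma vershik_iter_domain k x : dom x -> dom (iter k T x).
Proof.
by move=> xD; elim: k => //= k IH; exact: vershik_step_domain (TV IH) IH.
Qed.

Lemma vershik_iter_continuous k n x : dom x ->
  exists m, forall y, dom y -> agree m x y -> agree n (iter k T x) (iter k T y).
Proof.
move=> xD; elim: k n => [|k IH] n; first by exists n.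
have [m Hm] := vershik_step_continuous n (TV (@vershik_iter_domain k _ xD)).
have [l Hl] := IH m; exists l => y yD xy /=.
by apply: Hm; [exact/TV/vershik_iter_domain|exact: Hl].
Qed.

Lemma vershik_iter_climb n j x : dom x ->
  j + rank x n < height (vtx x n) ->
  vtx (iter j T x) n = vtx x n /\ rank (iter j T x) n = j + rank x n.
Proof.
move=> xD; elim: j => //= j IH jx; have [|v r] := IH; first exact: ltnW.
have [|-> ->] := (vershik_step_rank n (TV (@vershik_iter_domain j _ xD))).1.
  by rewrite v r.
by rewrite v r.
Qed.

Lemma vershik_iter_return n x : dom x ->
  (forall w : vertex B n, rank x n < height w) ->
  rank (iter (height (vtx x n)) T x) n = rank x n.
Proof.
move=> xD xlow; set t := rank x n; set h := height _.
have th : t < h by exact: xlow.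
(* The top is h - t - 1 steps away, one more step reaches the bottom of some tower, and t further
   steps climb to its floor t. *)
have hE : h = t + (h - t.+1).+1 by rewrite addnS -addSn subnKC.
pose z := iter (h - t.+1) T x; have zD : dom z by exact: vershik_iter_domain.
have [|v r] := @vershik_iter_climb n (h - t.+1) x xD.
  by rewrite -/t -/h -addnS subnK.
have Tz : rank (T z) n = 0.
  by apply: (vershik_step_rank n (TV zD)).2; rewrite r v -/t -/h -addnS subnK.
rewrite hE iterD iterS -/z.
have [||_ ->] := @vershik_iter_climb n t (T z).
- exact: vershik_step_domain (TV zD) zD.
- by rewrite Tz addn0 xlow.
by rewrite Tz addn0.
Qed.

(* [u] lists the towers visited by an orbit; two equal entries, at positions i
   and j, cut out a loop of the orbit. *)
Definition loop_start n d (u : 'I_d.+1 -> vertex B n) (i : nat) : nat :=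
  \sum_(k < d.+1 | k < i) height (u k).

Definition loop_length n d (u : 'I_d.+1 -> vertex B n) (i j : nat) : nat :=
  \sum_(k < d.+1 | i <= k < j) height (u k).

Lemma loop_length_ge n d (u : 'I_d.+1 -> vertex B n) (i j : 'I_d.+1) K :
  (forall w : vertex B n, K <= height w) -> i < j -> K <= loop_length u i j.
Proof.
move=> Kw ij; rewrite /loop_length (bigD1 i) ?leqnn //=.
exact: leq_trans (Kw _) (leq_addr _ _).
Qed.

(** Pigeonhole on the towers at the first d+1 visits to one floor. A repeated tower gives equal
    vertex and rank; start and length of the loop depend only on [i], [j] and [u]. *)
Lemma vershik_loop n d x : #|vertex B n| <= d -> dom x ->
  (forall w : vertex B n, rank x n < height w) ->
  exists (i j : 'I_d.+1) (u : {ffun 'I_d.+1 -> vertex B n}), i < j /\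
    agree n (iter (loop_start u i) T x)
      (iter (loop_length u i j) T (iter (loop_start u i) T x)).
Proof.
move=> Bd xD xlow.
(* [S l] is the total height of the first l towers visited, hence the time of the l-th return. *)
pose S := fix S l := if l is l'.+1
  then height (vtx (iter (S l') T x) n) + S l' else 0.
pose u := [ffun k : 'I_d.+1 => vtx (iter (S k) T x) n].
have SE l : S l = \sum_(k < l) height (vtx (iter (S k) T x) n).
  by elim: l => [|l IH]; rewrite ?big_ord0 // big_ord_recr /= addnC -IH.
have rS l : rank (iter (S l) T x) n = rank x n.
  elim: l => //= l IH; rewrite iterD vershik_iter_return //.
    exact: vershik_iter_domain.
  by move=> w; rewrite IH.
have startE (i : 'I_d.+1) : loop_start u i = S i.
  rewrite SE (big_ord_widen _ (fun k => height (vtx (iter (S k) T x) n)) (ltnW (ltn_ord i))).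
  by apply: eq_bigr => k _; rewrite ffunE.
have [i [j [ij uij]]] : exists i j : 'I_d.+1, i < j /\ u i = u j.
  have /injectivePn[i [j ij uij]] : ~~ injectiveb u.
    apply/negP => /injectiveP/leq_card; rewrite card_ord => du.
    by have := leq_trans du Bd; rewrite ltnn.
  by case: (ltngtP i j) ij => [l|l|/val_inj->]; [exists i, j|exists j, i|rewrite eqxx].
exists i, j, u; split=> //.
have lengthE : loop_length u i j + loop_start u i = S j.
  rewrite -startE /loop_start [RHS](bigID (fun k : 'I_d.+1 => k < i)) /= addnC.
  congr addn; apply: eq_bigl => k; last by rewrite -leqNgt andbC.
  by case: (ltnP k i) => [/ltn_trans->|]; rewrite ?andbF.
rewrite -iterD lengthE startE; apply: rank_agree; last by rewrite !rS.
by move: uij; rewrite !ffunE.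
Qed.

End Map.
End Dynamics.

(** * Measures *)

Section MeasureGeneralities.
Context d (X : measurableType d) (R : realType).
Local Open Scope ereal_scope.

Lemma bigcup_enum (I : finType) (P : pred I) (F : I -> set X) :
  [set x | exists2 i, P i & F i x] = \bigcup_(i in [set` enum P]) F i.
Proof.
by apply/seteqP; split=> x [i Pi Fi]; exists i; rewrite //= ?mem_enum // in Pi *.
Qed.

Lemma measure_fin_partition (mu : {measure set X -> \bar R}) (I : finType)
    (P : pred I) (F : I -> set X) :
  (forall i, measurable (F i)) ->
  (forall i j x, F i x -> F j x -> i = j) ->
  mu [set x | exists2 i, P i & F i x] = \sum_(i | P i) mu (F i).
Proof.
move=> mF dF; have tF : trivIset [set` enum P] F.
  by move=> i j _ _ [x [Fi Fj]]; exact: dF Fi Fj.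
rewrite bigcup_enum (measure_fin_bigcup mu (finite_seq _) tF (fun i _ => mF i)).
by rewrite -fsbig_seq ?enum_uniq // big_enum.
Qed.

Lemma measurable_fin_union (I : finType) (P : pred I) (F : I -> set X) :
  (forall i, measurable (F i)) -> measurable [set x | exists2 i, P i & F i x].
Proof.
by move=> mF; rewrite bigcup_enum; apply: fin_bigcup_measurable.
Qed.

Lemma measure_fin_cover (mu : {measure set X -> \bar R}) (I : finType)
    (P : pred I) (F : I -> set X) :
  (forall i, measurable (F i)) ->
  mu [set x | exists2 i, P i & F i x] <= \sum_(i | P i) mu (F i).
Proof.
move=> mF; have := measurable_fin_union P mF; rewrite bigcup_enum => mU.
rewrite -[leRHS]big_enum [leRHS]fsbig_seq ?enum_uniq //.
exact: content_sub_fsum.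
Qed.

Lemma nonatomic_set1 (mu : {measure set X -> \bar R}) x :
  measurable [set x] -> nonatomic mu -> mu [set x] = 0.
Proof.
move=> mx mu_na; apply/eqP; rewrite eq_le measure_ge0 andbT leNgt.
apply/negP => /(mu_na _ mx)[C [_ Cx C0]].
have [C_0|/set0P[y Cy]] := eqVneq C set0; first by rewrite C_0 measure0 ltxx in C0.
suff -> : C = [set x] by rewrite ltxx.
by apply/seteqP; split=> // _ ->; have <- : y = x by exact: Cx.
Qed.

Lemma countable_null (mu : {measure set X -> \bar R}) (A : set X) :
  (forall x : X, measurable [set x]) -> (forall x, mu [set x] = 0) ->
  countable A -> mu A = 0.
Proof.
move=> m1 mu1 cA; apply: measure_negligible; first exact: countable_measurable.
have [f finj] := elimT (countable_injP _) cA.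
have -> : A = \bigcup_n (A `&` f @^-1` [set n]).
  by apply/seteqP; split=> [x Ax|x [n _ []//]]; exists (f x).
apply: negligible_bigcup => n.
have [[x [Ax fx]]|A0] := pselect (exists x, (A `&` f @^-1` [set n]) x).
  exists [set x]; split=> // y [Ay fy]; apply: finj; rewrite ?inE //.
  by rewrite fx fy.
by exists set0; split=> // y Ay; case: A0; exists y.
Qed.

End MeasureGeneralities.

(** * Cylinder topology and the floors of the towers *)

Section Topology.
Context (B : bratteli).
Implicit Types x y : path_space B.

Lemma follows_exists x n : exists p : fin_path Defs.root (vtx x n), follows x p.
Proof.
elim: n => [|n [p xp]].
  by rewrite (vertex0_root (vtx x 0)); exists (fp_nil Defs.root).
by rewrite vtxS; exists (fp_rcons p).
Qed.

Lemma open_agree (U : set (path_space B)) :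
  (forall x, U x -> exists n, agree n x `<=` U) -> open U.
Proof.
move=> HU; exists [set C | cylinders C /\ C `<=` U]; first by move=> C [].
apply/seteqP; split=> [x [C [_ CU] Cx]|x Ux]; first exact: CU.
have [n nU] := HU _ Ux; have [p xp] := follows_exists x n.
exists (cylinder p) => //; split; first by exists n, (vtx x n), p.
by move=> y yp; apply: nU; exact/(followsE _ xp).
Qed.

Lemma measurable_agree (U : set (borel_path B)) :
  (forall x, U x -> exists n, agree n x `<=` U) -> measurable U.
Proof. by move=> HU; apply: sub_sigma_algebra; exact: open_agree. Qed.

Lemma measurable_path1 (x : borel_path B) : measurable [set x].
Proof.
have -> : [set x] = \bigcap_n (agree n x : set (borel_path B)).
  apply/seteqP; split=> [_ -> n _ //|y xy].
  by apply/esym/path_space_ext => n; apply/esym/(xy n.+1).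
apply: bigcapT_measurable => n; apply: measurable_agree => y xy.
by exists n => z; exact: agree_trans.
Qed.

End Topology.

Section Cells.
Context {B : ordered_bratteli} {R : realType}.
Context (mu : {measure set (borel_path B) -> \bar R}).
Context (mu_inv : invariant_measure mu).
Implicit Types x y : path_space B.

(** Floor [t] of the tower over [w]; empty when [t] is at least [height w]. *)
Definition cell n (w : vertex B n) (t : nat) : set (borel_path B) :=
  [set x | vtx x n = w /\ rank x n = t].

Lemma cell_agree n (w : vertex B n) t x y : cell w t x -> agree n x y <-> cell w t y.
Proof.
move=> [xw xt]; split=> [xy|[yw yt]].
  by split; rewrite ?(agree_vtx xy) ?(agree_rank xy).
by apply: rank_agree; rewrite ?xw ?xt.
Qed.

Lemma measurable_cell n (w : vertex B n) t : measurable (cell w t).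
Proof. by apply: measurable_agree => x xw; exists n => y /(cell_agree y xw). Qed.

Lemma cell_cylinder n (w : vertex B n) t : (t < height w)%N ->
  exists p : fin_path Defs.root w, cell w t = cylinder p.
Proof.
move=> /path_rank_onto[p <-]; exists p; apply/seteqP.
by split=> x; [move/followsP|move/followsP].
Qed.

Lemma measure_cell_eq n (w : vertex B n) s t :
  (s < height w)%N -> (t < height w)%N -> mu (cell w s) = mu (cell w t).
Proof. by move=> /cell_cylinder[p ->] /cell_cylinder[q ->]; exact: mu_inv.2. Qed.

Definition cell_index n := {w : vertex B n & 'I_(height w)}.

Definition cells n (i : cell_index n) : set (borel_path B) :=
  cell (tag i) (tagged i).

Definition index_of n x : cell_index n :=
  Tagged (fun w => 'I_(height w)) (Ordinal (rank_height x n)).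

Lemma cells_index n x : cells (index_of n x) x.
Proof. by []. Qed.

Lemma cells_inj n (i j : cell_index n) x : cells i x -> cells j x -> i = j.
Proof.
case: i j => [v s] [w t] [/= xv xs] [/= xw xt]; subst v w.
by congr existT; apply: val_inj; rewrite /= -xs.
Qed.

Lemma cells_agree n x y : agree n x y <-> cells (index_of n x) y.
Proof. exact: cell_agree. Qed.

End Cells.

(** * Invariance and return times *)

Section Probability.
Context {B : ordered_bratteli} {R : realType}.
Context (mu : probability (borel_path B) R).
Context (mu_inv : invariant_measure mu).
Context (B_fr : finite_rank B).
Context (T : path_space B -> path_space B) (TV : vershik_map T).
Implicit Types x y : path_space B.
Implicit Types E : set (borel_path B).
Local Notation dom := (@vershik_domain B).
Local Open Scope ereal_scope.

(** [K] floors of the tower are disjoint, have equal mass, and fit into total mass 1. *)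
Lemma measure_cell_le n (w : vertex B n) t K :
  (t < height w)%N -> (0 < K <= height w)%N -> mu (cell w t) <= (K%:R^-1)%:E.
Proof.
move=> tw /andP[K0 Kw].
have : mu [set x | exists2 i : 'I_K, predT i & cell w i x] <= 1.
  by apply: probability_le1; apply: measurable_fin_union => i; exact: measurable_cell.
rewrite measure_fin_partition; last 2 first.
- by move=> i; exact: measurable_cell.
- by move=> i j x [_ xi] [_ xj]; apply: val_inj; rewrite /= -xi.
have [r muE] : exists r, mu (cell w t) = r%:E.
  by exists (fine (mu (cell w t))); rewrite fineK ?fin_num_measure //; exact: measurable_cell.
rewrite (eq_bigr (fun=> r%:E)) => [|i _]; last first.
  by rewrite -muE; exact: (measure_cell_eq mu_inv (leq_trans (ltn_ord i) Kw) tw).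
rewrite muE sumEFin !lee_fin sumr_const card_ord -(mulr_natl r K).
by rewrite -ler_pdivlMl ?ltr0n // mulr1.
Qed.

Lemma measurable_domC E : E `<=` ~` dom -> measurable E.
Proof.
move=> Edom; apply: countable_measurable; first exact: measurable_path1.
by apply: sub_countable (vershik_domainC_countable B_fr); exact: subset_card_le.
Qed.

Lemma measure_domC E : E `<=` ~` dom -> mu E = 0.
Proof.
move=> Edom; apply: countable_null.
- exact: measurable_path1.
- move=> x; apply: nonatomic_set1; [exact: measurable_path1|exact: mu_inv.1].
by apply: sub_countable (vershik_domainC_countable B_fr); exact: subset_card_le.
Qed.

Lemma measurable_dom : measurable (dom : set (borel_path B)).
Proof.
rewrite -[X in measurable X]setCK; apply: measurableC; exact: measurable_domC.
Qed.

(** The complement of X_B^* is null, so inclusions need checking on X_B^* only. *)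
Lemma measure_mod_le (A C : set (borel_path B)) : measurable A -> measurable C ->
  A `&` dom `<=` C -> mu A <= mu C.
Proof.
move=> mA mC AC; rewrite -(setUIDK A dom) measureU0.
- by apply: le_measure; rewrite ?inE //; exact: measurableI measurable_dom.
- exact: measurableI measurable_dom.
- by apply: measurable_domC; exact: subIsetr.
- by apply: measure_domC; exact: subIsetr.
Qed.

(* Open relative to X_B^*, where [T] is continuous; elsewhere [T] is arbitrary,
   but the complement of X_B^* is countable. *)
Definition relopen E : Prop :=
  forall x, dom x -> E x -> exists n, agree n x `&` dom `<=` E.

Lemma measurable_relopen E : relopen E -> measurable E.
Proof.
move=> oE; pose U : set (borel_path B) :=
  [set x | exists n, agree n x `&` dom `<=` E].
have mU : measurable U.
  apply: measurable_agree => x [n xn]; exists n => y xy; exists n => z [yz zD].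
  by apply: xn; split=> //; exact: agree_trans xy yz.
have -> : E = (U `&` dom) `|` (E `&` ~` dom).
  apply/seteqP; split=> x.
    move=> Ex; have [xD|nD] := pselect (dom x); last by right.
    by left; split=> //; exact: oE.
  by case=> [[[n xn] xD]|[]//]; apply: xn.
apply: measurableU; first exact: measurableI measurable_dom.
by apply: measurable_domC => x [].
Qed.

Lemma relopenI E F : relopen E -> relopen F -> relopen (E `&` F).
Proof.
move=> oE oF x xD [/(oE x xD)[n xn] /(oF x xD)[m xm]].
exists (maxn n m) => y [xy yD]; split.
  by apply: xn; split=> //; apply: agreeW xy; exact: leq_maxl.
by apply: xm; split=> //; apply: agreeW xy; exact: leq_maxr.
Qed.

Lemma relopen_iter k E : relopen E -> relopen (iter k T @^-1` E).
Proof.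
move=> oE x xD /(oE _ (vershik_iter_domain TV xD))[n xn].
have [m xm] := vershik_iter_continuous TV k n xD; exists m => y [xy yD].
by apply: xn; split; [exact: xm|exact: vershik_iter_domain].
Qed.

(* Up to a null set [T] moves a floor which is not the top of its tower onto the
   next floor, and every point is below the top of all high enough towers. *)
Lemma measure_vershik_preimage E : relopen E -> mu (T @^-1` E) <= mu E.
Proof.
move=> oE; have mE := measurable_relopen oE.
pose up n (i : @cell_index B n) := cell (tag i) (tagged i).+1.
pose P n (i : @cell_index B n) :=
  `[< ((tagged i).+1 < height (tag i))%N /\ up n i `&` dom `<=` E >].
(* [D n] approximates the preimage from inside, by the cells of level n that have a next floor
   contained in E up to points outside X_B^*. *)
pose D n : set (borel_path B) := [set x | exists2 i, P n i & cells i x].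
have DE n x : D n x <-> ((rank x n).+1 < height (vtx x n))%N /\
    cell (vtx x n) (rank x n).+1 `&` dom `<=` E.
  split=> [[i /asboolP Pi xi]|xE].
    by move: Pi; rewrite (cells_inj xi (cells_index n x)).
  by exists (index_of n x) => //; apply/asboolP.
have mD n : measurable (D n).
  by apply: measurable_fin_union => i; exact: measurable_cell.
have muD n : mu (D n) <= mu E.
  rewrite measure_fin_partition; last 2 first.
  - by move=> i; exact: measurable_cell.
  - by move=> i j x; exact: cells_inj.
  (* Replace each cell by the next floor, of equal mass; these floors are again disjoint. *)
  rewrite (eq_bigr (fun i => mu (up n i))); last first.
    by move=> i /asboolP[iw _]; apply: measure_cell_eq.
  rewrite -measure_fin_partition; last 2 first.
  - by move=> i; exact: measurable_cell.
  - move=> [v s] [w t] x [/= xv xs] [/= xw xt]; subst v w.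
    by congr existT; apply: val_inj; apply: succn_inj; rewrite /= -xs.
  apply: measure_mod_le => //.
    by apply: measurable_fin_union => i; exact: measurable_cell.
  by move=> x [[i /asboolP[_ iE] xi] xD]; apply: iE.
(* The floor above a cell of level n+1 lies in the floor above the cell of level n containing it. *)
have Dmono : {homo D : n m / (n <= m)%N >-> (n <= m)%O}.
  apply: homo_leq => [A|A C F|n]; [exact: lexx|exact: le_trans|].
  apply/subsetPset => x /DE[xh xE]; apply/DE; rewrite vtxS rankS.
  split; first by rewrite -rankS -vtxS; exact: below_topS.
  move=> y [[yv yr] yD]; apply: xE; split=> //.
  move: yv yr; rewrite vtxS rankS -addSn => yv /esym.
  move=> /(below_inj (esym yv) xh (rank_height y n))[xy r].
  by split; rewrite ?r // /vtx xy.
have mUD : measurable (\bigcup_n D n) by exact: bigcupT_measurable.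
apply: (@le_trans _ _ (mu (\bigcup_n D n))).
  apply: measure_mod_le => //.
    by apply: measurable_relopen; exact: (relopen_iter (k := 1)).
  move=> x [TxE xD]; have xT := TV xD.
  have [n xn] := oE _ (vershik_step_domain xT xD) TxE.
  have [k xk] := vershik_step_below_top xT.
  exists (maxn n k) => //; apply/DE; set m := maxn _ _.
  have xm := xk m (leq_maxr _ _); have [v r] := (vershik_step_rank m xT).1 xm.
  split=> // y [ym yD]; apply: xn; split=> //.
  apply: (agreeW (leq_maxl n k)); rewrite -/m.
  by apply/(@cell_agree _ m (vtx x m) (rank x m).+1).
have cvgD := nondecreasing_cvg_mu (mu := mu) mD mUD Dmono.
have <- : limn (mu \o D) = mu (\bigcup_n D n) by exact/cvg_lim.
by apply: lime_le; [exact: cvgP cvgD|apply: nearW => n; exact: muD].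
Qed.

Lemma measure_vershik_iter_preimage k E :
  relopen E -> mu (iter k T @^-1` E) <= mu E.
Proof.
elim: k E => [|k IH] E oE; first exact: lexx.
apply: le_trans (IH _ (relopen_iter (k := 1) oE)) _.
exact: measure_vershik_preimage.
Qed.

Definition agree_after m q : set (borel_path B) :=
  [set x | agree m x (iter q T x)].

Lemma relopen_agree_after m q : relopen (agree_after m q).
Proof.
move=> x xD xq; have [n xn] := vershik_iter_continuous TV q m xD.
exists (maxn n m) => y [xy yD]; have xym := agreeW (leq_maxr _ _) xy.
apply: agree_trans (agree_sym xym) _; apply: agree_trans xq _.
by apply: xn => //; exact: agreeW (leq_maxl _ _) xy.
Qed.

(* Through any floor below the top of the lowest tower there passes a loop, so
   the lowest tower is covered by preimages of a bounded number of sets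
   [agree_after m q]. *)
Lemma agree_after_lower_bound n m d K (c : R) :
  (#|vertex B n| <= d)%N -> (m <= n)%N -> (0 < c)%R ->
  (forall w : vertex B n, K <= height w)%N ->
  (forall w : vertex B n, c%:E <= mu [set x | vtx x n = w]) ->
  exists2 q, (K <= q)%N &
    (c / (d.+1 * d.+1 * d ^ d.+1).+1%:R)%:E <= mu (agree_after m q).
Proof.
move=> Bd mn c0 Kw cw; set N := (_ * _)%N.
pose I : finType := ('I_d.+1 * 'I_d.+1 * {ffun 'I_d.+1 -> vertex B n})%type.
have IN : (#|{: I}| <= N)%N.
  rewrite /I !card_prod !card_ord card_ffun card_ord leq_mul2l /=.
  by rewrite leq_exp2r ?Bd ?orbT.
apply: contrapT => noq.
have small q : (K <= q)%N -> mu (agree_after m q) <= (c / N.+1%:R)%:E.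
  by move=> Kq; rewrite leNgt; apply/negP => /ltW H; apply: noq; exists q.
pose w0 := vtx (point : path_space B) n.
(* A floor of the lowest tower exists in every tower, as [vershik_loop] demands. *)
case: (arg_minnP (P := predT) (@height B n) (isT : predT w0)) => w _ wmin.
pose s (i : I) := loop_start i.2 i.1.1.
pose q (i : I) := loop_length i.2 i.1.1 i.1.2.
pose F (i : I) : set (borel_path B) := iter (s i) T @^-1` agree_after m (q i).
pose P (i : I) := (i.1.1 < i.1.2)%N.
have mF i : measurable (F i).
  by apply: measurable_relopen; apply: relopen_iter; exact: relopen_agree_after.
have mw : measurable ([set x | vtx x n = w] : set (borel_path B)).
  by apply: measurable_agree => x xw; exists n => y xy; rewrite /= (agree_vtx xy).
have : c%:E <= \sum_(i | P i) mu (F i).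
  apply: le_trans (cw w) _; apply: le_trans (measure_fin_cover mu P mF).
  apply: measure_mod_le => //; first exact: measurable_fin_union.
  move=> x [xw xD].
  have [|i [j [u [ij xu]]]] := vershik_loop TV Bd xD.
    by move=> v; apply: leq_trans (wmin v isT); rewrite -xw rank_height.
  by exists (i, j, u) => //; exact: agreeW mn xu.
apply/negP; rewrite -ltNge.
apply: (@le_lt_trans _ _ (\sum_(i | P i) (c / N.+1%:R)%:E)).
  apply: lee_sum => i Pi; apply: le_trans (small (q i) _).
    by apply: measure_vershik_iter_preimage; exact: relopen_agree_after.
  exact: loop_length_ge.
(* There are at most N terms, so the denominator N+1 makes the sum strictly less than c. *)
rewrite sumEFin lte_fin sumr_const -(mulr_natl (c / N.+1%:R)) mulrA.
rewrite ltr_pdivrMr ?ltr0n // mulrC ltr_pM2l // ltr_nat ltnS.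
exact: leq_trans (max_card _) IN.
Qed.

Lemma relopen_cells n (i : cell_index n) : relopen (cells i).
Proof. by move=> x _ xi; exists n => y [xy _]; exact/(cell_agree y xi). Qed.

(** To agree up to level m is to lie in the same cell; in this form mixing applies cell by cell. *)
Lemma agree_after_cells m q : mu (agree_after m q) =
  \sum_(i : cell_index m) mu (cells i `&` (iter q T @^-1` cells i)).
Proof.
rewrite -measure_fin_partition; last 2 first.
- move=> i; apply: measurable_relopen; apply: relopenI.
    exact: relopen_cells.
  by apply: relopen_iter; exact: relopen_cells.
- by move=> i j x [xi _] [xj _]; exact: cells_inj xi xj.
congr (mu _); apply/seteqP; split=> [x xq|x [i _ [xi xqi]]].
  exists (index_of m x) => //; split=> //; exact/cells_agree.
exact/(cell_agree _ xi).
Qed.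

End Probability.

(** * Tower masses and the failure of mixing *)

Lemma invariant_mnormalize (R : realType) (B : bratteli)
    (nu : {measure set (borel_path B) -> \bar R})
    (P : probability (borel_path B) R) :
  (0 < nu setT < +oo)%E -> invariant_measure nu ->
  invariant_measure (mnormalize nu P).
Proof.
move=> /andP[nu0 nuoo] [nu_na nu_inv]; set m := (X in invariant_measure X).
(* The total mass is neither zero nor infinite, so [mnormalize] rescales [nu] instead of returning
   its default [P]. *)
have nuE A : m A = (nu A * (fine (nu setT))^-1%:E)%E.
  by rewrite /m /= /mnormalize gt_eqF //= lt_eqF.
have r0 : 0 < (fine (nu setT))^-1 by rewrite invr_gt0 fine_gt0 ?nu0.
split=> [A mA|n w p q]; last by rewrite !nuE (nu_inv _ _ p q).
rewrite nuE pmule_lgt0 ?lte_fin // => /(nu_na _ mA)[C [mC CA C0 CltA]].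
by exists C; split; rewrite // !nuE ?pmule_lgt0 ?lte_pmul2r ?lte_fin.
Qed.

(** By uniqueness [mu] is the normalization of [nu] on Borel sets, so towers at the kept levels,
    which are arbitrarily high, have mass at least [delta] divided by the total mass of [nu]. *)
Lemma exact_finite_rank_tower (R : realType) (B : bratteli)
    (mu : probability (borel_path B) R) :
  exact_finite_rank R B -> unique_invariant_probability mu ->
  exists2 c : R, 0 < c & forall n, exists2 m, (n <= m)%N &
    forall w : vertex B m, (c%:E <= mu [set x | vtx x m = w])%E.
Proof.
move=> [_ [nu [delta [l [nu_inv delta0 l_incr nu_tower]]]]] [_ mu_uniq].
have mtower n (v : vertex B n.+1) : measurable (tower v : set (borel_path B)).
  apply: measurable_agree => x xv; exists n.+1 => y xy.
  by rewrite /tower /= -vtxS (agree_vtx xy) vtxS.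
have nu_fin : (nu setT < +oo)%E by rewrite ltey_eq fin_num_measure.
have nu_gt0 : (0 < nu setT)%E.
  apply: (@lt_le_trans _ _ delta%:E); first by rewrite lte_fin.
  have v := rng ((point : path_space B) (l 0)).
  by apply: le_trans (nu_tower _ v) _; apply: le_measure; rewrite ?inE.
have muE A : measurable A -> mu A = (nu A * (fine (nu setT))^-1%:E)%E.
  move=> mA; rewrite -(mu_uniq (mnormalize nu mu)) //; last first.
    by apply: invariant_mnormalize => //; rewrite nu_gt0.
  by rewrite /= /mnormalize (gt_eqF nu_gt0) (lt_eqF nu_fin).
have r0 : 0 < (fine (nu setT))^-1 by rewrite invr_gt0 fine_gt0 ?nu_gt0.
exists (delta * (fine (nu setT))^-1); first exact: mulr_gt0.
have l_ge k : (k <= l k)%N.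
  by elim: k => // k IH; exact: leq_ltn_trans IH (l_incr k).
move=> n; exists (l n).+1; first exact: leqW.
move=> w; have -> : [set x | vtx x (l n).+1 = w] = tower w.
  by apply/seteqP; split=> x; rewrite /tower /= vtxS.
by rewrite muE // EFinM lee_wpmul2r // lee_fin ltW.
Qed.

Theorem theorem7p2 (R : realType) (B : ordered_bratteli)
    (mu : probability (borel_path B) R)
    (T : path_space B -> path_space B) :
  standing_assumptions B ->
  simple_diagram B ->
  exact_finite_rank R B ->
  unique_invariant_probability mu ->
  vershik_map T ->
  ~ strongly_mixing mu T.
Proof.
move=> [_ _ _ B_inf] B_simple B_exact mu_uniq TV mixing.
have [[d Bd] _] := B_exact; have mu_inv := mu_uniq.1.
have [c c0 c_tower] := exact_finite_rank_tower B_exact mu_uniq.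
have h_unbounded := height_unbounded B_simple (B_inf point).
(* The bound of [agree_after_lower_bound] involves only c and d, so m can be chosen after b, and n
   after m. *)
set b := c / (d.+1 * d.+1 * d ^ d.+1).+1%:R.
have b0 : 0 < b by rewrite divr_gt0 ?ltr0n.
have [K K0 Kb] : exists2 K, (0 < K)%N & K%:R^-1 < b.
  exists (Num.truncn b^-1).+1 => //.
  by rewrite invf_plt ?posrE ?ltr0n // truncnS_gt.
have [m Km] := h_unbounded K; have {}Km w := Km m w (leqnn m).
pose L := (\sum_(i : @cell_index B m) mu (cells i) * mu (cells i))%E.
have Lb : (L < b%:E)%E.
  apply: (@le_lt_trans _ _ K%:R^-1%:E); last by rewrite lte_fin.
  (* One factor of each square is at most 1/K, and the remaining factors sum to at most 1. *)
  apply: (@le_trans _ _ (\sum_(i : @cell_index B m) mu (cells i) * K%:R^-1%:E)%E).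
    apply: lee_sum => i _; apply: lee_wpmul2l => //.
    by apply: measure_cell_le => //; rewrite K0 Km.
  rewrite -ge0_sume_distrl // -measure_fin_partition; last 2 first.
  - by move=> i; exact: measurable_cell.
  - by move=> i j x; exact: cells_inj.
  rewrite -[leRHS]mul1e lee_wpmul2r ?lee_fin ?invr_ge0 //.
  apply: probability_le1; apply: measurable_fin_union => i; exact: measurable_cell.
have B_fr : finite_rank B by exists d.
have limL : mu (agree_after T m q) @[q --> \oo] --> L.
  under eq_fun => q do rewrite (agree_after_cells mu B_fr TV).
  apply: cvg_nnesum => [i _|i _]; first exact: nearW.
  by apply: mixing; exact: measurable_cell.
have nbhsL : nbhs L [set y | (y < b%:E)%E].
  by apply: open_nbhs_nbhs; split=> //; exact: open_ereal_lt_ereal.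
have [Q _ Qb] := limL _ nbhsL.
(* Where all towers have height at least [Q], loops have length at least [Q], and for such times
   mixing has already forced the mass of [agree_after] below b. *)
have [N QN] := h_unbounded Q.
have [n Nmn cn] := c_tower (maxn N m).
have [q Qq] := agree_after_lower_bound mu_inv B_fr TV (Bd n)
  (leq_trans (leq_maxr N m) Nmn) c0
  (fun w => QN n w (leq_trans (leq_maxl N m) Nmn)) cn.
by rewrite leNgt Qb.
Qed.
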